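(* For every connectivity matrix $\mathbf{G}\in\{0,1\}^{k\times k}$ that is not block-diagonal, there exists an instance $(\boldsymbol{\nu},\mathbf{G},T)$ of Rotting Graph-Triggered Bandits such that, for every policy $\pi$, it holds that $$R_{\boldsymbol{\nu},\mathbf{G},T}(\pi)\ge\frac{T}{12}.$$
   Context: Graph-Triggered Bandits (GTB): there are $k$ arms, a horizon $T\in\mathbb{N}$, and a connectivity matrix, i.e. a symmetric $\mathbf{G}\in\{0,1\}^{k\times k}$ with $\mathbf{G}_{i,i}=1$ for all $i\in[k]$. An instance is a triple $(\boldsymbol{\nu},\mathbf{G},T)$, where $\boldsymbol{\nu}=(\nu_{i,n})_{i\in[k],n\in[T]}$ is a family of subgaussian reward distributions with means $\mu_i(n)\in[0,1]$ (deterministic rewards are allowed). At each round $t\in[T]$ a policy $\pi$ selects an arm $I_t$ as a function of the past history of pulled arms and observed rewards. The number of triggers of arm $i$ up to and including round $t$ is $\widetilde N_{i,t}=\sum_{\tau\le t}\mathbf{1}\{\mathbf{G}_{I_\tau,i}=1\}$. The agent observes only a reward drawn from $\nu_{I_t,n}$ with $n=\widetilde N_{I_t,t}$. Performance: $J_{\boldsymbol{\nu},\mathbf{G},T}(\pi)=\mathbb{E}[\sum_{t=1}^T\mu_{I_t}(\widetilde N_{I_t,t})]$; regret: $R_{\boldsymbol{\nu},\mathbf{G},T}(\pi)=\max_{\pi'}J_{\boldsymbol{\nu},\mathbf{G},T}(\pi')-J_{\boldsymbol{\nu},\mathbf{G},T}(\pi)$. Rotting: $\mu_i(n+1)\le\mu_i(n)$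 for every arm $i$ and every $n$. $\mathbf{G}$ is block-diagonal if there is a partition of $[k]$ (into cliques) such that $\mathbf{G}_{i,j}=1$ if and only if $i,j$ are in the same class of the partition.
   Formalization: The quantifiers are reordered: for every horizon T and every policy there is a rotting instance over G with regret at least T/12; with one instance fixed for all policies the claim fails for T ≥ 1, as the maximising policy has regret 0. *)

(* Defs.v *)
From HB Require Import structures.
From mathcomp Require Import all_boot all_order all_algebra.
From mathcomp Require Import all_classical all_reals all_analysis.

Set Implicit Arguments.
Unset Strict Implicit.
Unset Printing Implicit Defensive.

Import Order.TTheory GRing.Theory Num.Theory.
Import numFieldNormedType.Exports.

Local Open Scope classical_set_scope.
Local Open Scope ring_scope.

Definition connectivity_matrix (k : nat) (G : 'M[bool]_k) : Prop :=
  G^T = G /\ forall i : 'I_k, G i i.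

Definition block_diagonal (k : nat) (G : 'M[bool]_k) : Prop :=
  exists2 P : {set {set 'I_k}}, finset.partition P [set: 'I_k]%SET &
    forall i j : 'I_k, G i j = [exists B in P, (i \in B) && (j \in B)].

Section GraphTriggeredBandit.
Context {R : realType} {k : nat}.

(* [nu i n] is the reward law of arm [i] at its [n]-th trigger; triggers are
   counted from 1, so only the values at 1 <= n <= T matter for horizon T. *)
Definition reward_family := 'I_k -> nat -> probability (measurableTypeR R) R.

Definition mean (nu : reward_family) (i : 'I_k) (n : nat) : R :=
  fine (\int[nu i n]_x x%:E)%E.

Definition subgaussian (P : probability (measurableTypeR R) R) (m : R) : Prop :=
  exists2 sigma : R, 0 <= sigma & forall l : R,
    (\int[P]_x (expR (l * (x - m)))%:E <=
       (expR (l ^+ 2 * sigma ^+ 2 / 2))%:E)%E.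

Definition gtb_rewards (nu : reward_family) (T : nat) : Prop :=
  forall (i : 'I_k) (n : nat), (0 < n <= T)%N ->
    [/\ (nu i n).-integrable setT (EFin : R -> \bar R),
        subgaussian (nu i n) (mean nu i n)
      & 0 <= mean nu i n <= 1].

Definition rotting (nu : reward_family) (T : nat) : Prop :=
  forall (i : 'I_k) (n : nat), (0 < n)%N -> (n.+1 <= T)%N ->
    mean nu i n.+1 <= mean nu i n.

(* Pulled arms and observed rewards, in chronological order. *)
Definition history := seq ('I_k * R).

(* Measurability, required for expectations to make sense, is stated on each
   slice of the histories with a given sequence of pulled arms. *)
Record policy := Policy {
  act :> history -> 'I_k;
  measurable_act : forall (t : nat) (a : t.-tuple 'I_k) (i : 'I_k),
    measurable [set x : t.-tuple (measurableTypeR R) | act (zip a x) = i]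
}.

Definition triggers (G : 'M[bool]_k) (a : seq 'I_k) (i : 'I_k) : nat :=
  count (fun j => G j i) a.

(* The sum over rounds t of mu_{I_t}(N_{I_t,t}), where a = (I_1, ..., I_T);
   the 0-based index t stands for round t.+1. *)
Definition total_mean (nu : reward_family) (G : 'M[bool]_k) (a : seq 'I_k) : R :=
  \sum_(t < size a)
    mean nu (tnth (in_tuple a) t)
            (triggers G (take t.+1 a) (tnth (in_tuple a) t)).

(* Expectation of [F] (full history) given the past [h] and [s] remaining
   rounds: the integral of [F] against the law of the history, written as the
   iterated integral over the successive conditional reward laws. *)
Fixpoint expect (nu : reward_family) (G : 'M[bool]_k) (pi : policy)
    (F : history -> \bar R) (s : nat) (h : history) : \bar R :=
  if s is s'.+1 then
    let i := pi h in
    let n := triggers G (rcons (unzip1 h) i) i in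
    (\int[nu i n]_x expect nu G pi F s' (rcons h (i, x)))%E
  else F h.

Definition performance (nu : reward_family) (G : 'M[bool]_k) (T : nat)
    (pi : policy) : \bar R :=
  expect nu G pi (fun h => (total_mean nu G (unzip1 h))%:E) T [::].

(* The maximum is taken as a supremum in the extended reals; for rewards
   satisfying [gtb_rewards] the performances lie in [0, T] and it is attained
   (by a fixed sequence of arms). *)
Definition regret (nu : reward_family) (G : 'M[bool]_k) (T : nat)
    (pi : policy) : \bar R :=
  (ereal_sup (range (performance nu G T)) - performance nu G T pi)%E.

End GraphTriggeredBandit.

Arguments reward_family R k : clear implicits.
Arguments policy R k : clear implicits.
Arguments history R k : clear implicits.

(* Main.v *)
(* A graph that is not block-diagonal contains an induced path e1 - c - e2.
   With m = T/2, the center c pays 1 for its first m triggers, and the two ends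
   pay a, about 2/3, for their first m triggers; other arms pay 0.
   If everything then dies, the best plan is to pull e1 and then e2, m times
   each, for 2am: these two arms do not trigger each other, while each early
   pull of c consumes budget of both and loses 2a - 1. If instead the ends keep
   paying a forever, the best plan is to pull c first, and each of the first m
   rounds not spent on c loses 1 - a. All rewards being deterministic, the two
   instances are indistinguishable during the first m rounds, so the number of
   pulls of c in these rounds is the same in both, and is bad for one of them. *)
Require Import Defs.
From HB Require Import structures.
From mathcomp Require Import all_boot all_order all_algebra.
From mathcomp Require Import all_classical all_reals all_analysis.
From mathcomp Require Import measurable_realfun.
From mathcomp Require Import zify ring lra.

Set Implicit Arguments.
Unset Strict Implicit.
Unset Printing Implicit Defensive.

Import Order.TTheory GRing.Theory Num.Theory.
Import HBNNSimple.

Local Open Scope ring_scope.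

(** Without an induced path on three vertices, adjacency is transitive, hence an equivalence
    relation, and its classes form the excluded partition into cliques. *)
Lemma not_block_diagonal_path (k : nat) (G : 'M[bool]_k) :
  connectivity_matrix G -> ~ block_diagonal G ->
  exists e1 c e2, [/\ G e1 c, G c e2 & ~~ G e1 e2].
Proof.
move=> [Gsym Gdiag]; apply: contra_notP => noP.
have sym i j : G i j = G j i by rewrite -{1}Gsym mxE.
have trans i j l : G i j -> G j l -> G i l.
  by move=> Gij Gjl; apply/negPn/negP => Gil; apply: noP; exists i, j, l.
have eqv : {in [set: 'I_k]%SET & &, equivalence_rel (fun i j => G i j)}.
  move=> i j l _ _ _; split=> // Gij.
  by apply/idP/idP; apply: trans => //; rewrite sym.
exists (equivalence_partition (fun i j => G i j) [set: 'I_k]%SET).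
  exact: equivalence_partitionP.
move=> i j; apply/idP/exists_inP => [Gij|[B /imsetP[x _ ->]]].
  exists [set y in [set: 'I_k]%SET | G i y]%SET.
    by apply/imsetP; exists i.
  by rewrite !inE Gdiag.
by rewrite !inE => /andP[Gxi Gxj]; apply: trans Gxj; rewrite sym.
Qed.

(** * Integration against Dirac measures *)

Section DiracIntegral.
Variable R : realType.

Let ge0_integral_dirac_any (r : R) (f : R -> R) : (forall x, 0 <= f x) ->
  (\int[@dirac _ (measurableTypeR R) r R]_x (f x)%:E = (f r)%:E)%E.
Proof.
move=> f0; rewrite ge0_integralTE; last by move=> x; rewrite lee_fin.
have sintegralE (h : {nnsfun (measurableTypeR R) >-> R}) :
    sintegral (@dirac _ (measurableTypeR R) r R) h = (h r)%:E.
  rewrite -integralT_nnsfun integral_dirac//; first by rewrite diracT mul1e.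
  exact/measurable_EFinP.
apply/eqP; rewrite eq_le; apply/andP; split.
  by apply/ge_ereal_sup => _ [h /= hf <-]; rewrite sintegralE.
have mr : measurable ([set r]%classic : set (measurableTypeR R)).
  exact: measurable_set1.
apply: ereal_sup_ubound; exists (scale_nnsfun (indic_nnsfun R mr) (f0 r)).
  move=> x /=; rewrite lee_fin /= /mindic indicE in_set1.
  by case: eqP => [->|_]; rewrite ?mulr1 ?mulr0.
by rewrite sintegralE /= /mindic indicE in_set1 eqxx mulr1.
Qed.

(* Singletons are measurable, so the supremum over simple functions below [f]
   is attained even when [f] is not measurable; this spares us any discussion
   of the measurability of the nested integrands in [expect]. *)
Lemma integral_dirac_any (r : R) (f : R -> R) :
  (\int[@dirac _ (measurableTypeR R) r R]_x (f x)%:E = (f r)%:E)%E.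
Proof.
rewrite integralE.
have -> : ((fun x => (f x)%:E)^\+ = (fun x => (Num.max (f x) 0)%:E))%E.
  by apply/funext => x; rewrite funeposE EFin_max.
have -> : ((fun x => (f x)%:E)^\- = (fun x => (Num.max (- f x) 0)%:E))%E.
  by apply/funext => x; rewrite funenegE EFin_max EFinN.
rewrite !ge0_integral_dirac_any; try by move=> x; rewrite le_max lexx orbT.
by rewrite -EFinB; congr EFin; rewrite !maxEle; do 2 case: ifP; lra.
Qed.

End DiracIntegral.

(** * Deterministic instances, on which each policy follows a single history *)

Section DeterministicRewards.
Variables (R : realType) (k : nat) (G : 'M[bool]_k).
Implicit Types (mu : 'I_k -> nat -> R) (pi : policy R k).

Definition dirac_family mu : reward_family R k :=
  fun i n => @dirac _ (measurableTypeR R) (mu i n) R.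

Lemma mean_dirac mu i n : mean (dirac_family mu) i n = mu i n.
Proof. by rewrite /mean (integral_dirac_any _ id). Qed.

Lemma gtb_rewards_dirac mu T :
  (forall i n, 0 <= mu i n <= 1) -> gtb_rewards (dirac_family mu) T.
Proof.
move=> mu01 i n _; rewrite mean_dirac; split=> //.
- apply/integrableP; split; first exact/measurable_EFinP.
  by under eq_integral do rewrite abse_EFin; rewrite integral_dirac_any ltry.
- exists 0 => // l.
  rewrite (integral_dirac_any _ (fun x => expR (l * (x - mu i n)))).
  by rewrite subrr mulr0 expr0n /= !(mulr0, mul0r).
Qed.

Definition play_round mu pi (h : history R k) : history R k :=
  rcons h (pi h, mu (pi h) (triggers G (rcons (unzip1 h) (pi h)) (pi h))).

Definition play mu pi t : history R k := iter t (play_round mu pi) [::].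

(** Each integral in [expect] is against a Dirac law, so it evaluates its integrand at the reward
    that [play_round] records. *)
Lemma performance_dirac mu pi T :
  performance (dirac_family mu) G T pi =
  (total_mean (dirac_family mu) G (unzip1 (play mu pi T)))%:E.
Proof.
pose V (h : history R k) := total_mean (dirac_family mu) G (unzip1 h).
suff expectE h : expect (dirac_family mu) G pi (fun h => (V h)%:E) T h =
    (V (iter T (play_round mu pi) h))%:E by exact: expectE.
elim: T h => [//|T IH] h; rewrite iterSr /=.
under eq_integral do rewrite IH.
exact: (integral_dirac_any _ (fun x => V _)).
Qed.

Lemma regret_dirac_ge mu pi pi' T :
  ((total_mean (dirac_family mu) G (unzip1 (play mu pi' T))
    - total_mean (dirac_family mu) G (unzip1 (play mu pi T)))%:E
   <= regret (dirac_family mu) G T pi)%E.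
Proof.
rewrite /regret (performance_dirac mu pi) EFinB leeB// -performance_dirac.
by apply: ereal_sup_ubound; exists pi'.
Qed.

Lemma size_play mu pi t : size (play mu pi t) = t.
Proof. by elim: t => //= t IH; rewrite size_rcons IH. Qed.

Lemma take_play mu pi t T :
  (t <= T)%N -> take t (play mu pi T) = play mu pi t.
Proof.
elim: T => [|T IH]; first by case: t.
rewrite leq_eqVlt => /predU1P[->|tT]; first by rewrite take_oversize ?size_play.
by rewrite /= /play_round -cats1 takel_cat ?size_play ?IH.
Qed.

Lemma triggers_rcons s i j :
  triggers G (rcons s i) j = (triggers G s j + G i j)%N.
Proof. by rewrite /triggers -cats1 count_cat /= addn0. Qed.

Lemma triggers_le s i : (triggers G s i <= size s)%N.
Proof. exact: count_size. Qed.

(** Within [m] rounds no arm is triggered more than [m] times, so the policy never observes a reward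
    on which the two families differ. *)
Lemma play_eq mu1 mu2 pi m t :
  (forall i n, (n <= m)%N -> mu1 i n = mu2 i n) ->
  (t <= m)%N -> play mu1 pi t = play mu2 pi t.
Proof.
move=> mu12; elim: t => //= t IH tm; rewrite IH ?(ltnW tm)//.
rewrite /play_round mu12// (leq_trans (triggers_le _ _))//.
by rewrite size_rcons size_map size_play.
Qed.

Lemma total_mean_rcons (nu : reward_family R k) s i :
  total_mean nu G (rcons s i) =
  total_mean nu G s + mean nu i (triggers G (rcons s i) i).
Proof.
rewrite /total_mean.
rewrite (eq_bigr (fun t : 'I_(size (rcons s i)) =>
  mean nu (nth i (rcons s i) t)
    (triggers G (take t.+1 (rcons s i)) (nth i (rcons s i) t)))); last first.
  by move=> t _; rewrite !(tnth_nth i).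
rewrite [in RHS](eq_bigr (fun t : 'I_(size s) =>
  mean nu (nth i s t) (triggers G (take t.+1 s) (nth i s t)))); last first.
  by move=> t _; rewrite !(tnth_nth i).
rewrite size_rcons big_ord_recr /= nth_rcons ltnn eqxx.
rewrite take_oversize ?size_rcons//; congr (_ + _).
apply: eq_bigr => t _; rewrite nth_rcons ltn_ord.
by rewrite -cats1 takel_cat.
Qed.

Lemma total_mean_nil (nu : reward_family R k) : total_mean nu G [::] = 0.
Proof. by rewrite /total_mean big_ord0. Qed.

(** The arm depends only on the length of the history, so the set is everything or empty. *)
Lemma schedule_measurable (f : nat -> 'I_k) (t : nat) (a : t.-tuple 'I_k)
    (i : 'I_k) :
  measurable
    [set x : t.-tuple (measurableTypeR R) | f (size (zip a x)) = i]%classic.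
Proof.
have [fi|fi] := eqVneq (f t) i.
  rewrite (_ : [set _ | _]%classic = setT); first exact: measurableT.
  by apply/seteqP; split=> x //= _; rewrite size_zip !size_tuple minnn.
rewrite (_ : [set _ | _]%classic = classical_sets.set0).
  exact: measurable0.
apply/seteqP; split=> x //=; rewrite size_zip !size_tuple minnn => fti.
by rewrite fti eqxx in fi.
Qed.

Definition schedule (f : nat -> 'I_k) : policy R k :=
  @Policy R k (fun h => f (size h)) (schedule_measurable f).

Lemma play_schedule mu f t : unzip1 (play mu (schedule f) t) = mkseq f t.
Proof.
elim: t => //= t IH.
by rewrite /play_round /unzip1 map_rcons -/(unzip1 _) IH mkseqS /= size_play.
Qed.

End DeterministicRewards.

(** * Rewards on an induced path: upper bounds for all arm sequences, lower bounds for two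
    schedules *)

Lemma count_take_rcons (A : Type) (p : pred A) m s x :
  count p (take m (rcons s x)) = (count p (take m s) + ((size s < m) && p x))%N.
Proof.
case: ltnP => sm /=; last by rewrite -cats1 takel_cat// addn0.
rewrite !take_oversize ?size_rcons//; last exact: ltnW.
by rewrite -cats1 count_cat /= addn0.
Qed.

(** Here [x] and [y] stand for the counts of an end and of the center: an increment of both survives
    the cap if one of them stays within [m]. *)
Lemma minn3_step (x x' y y' m b : nat) : (x + b <= x')%N -> (y + b <= y')%N ->
  (x + b <= m)%N || (y + b <= m)%N || (b == 0)%N ->
  (minn (minn x y) m + b <= minn (minn x' y') m)%N.
Proof. lia. Qed.

Section Path.
Variables (R : realType) (k : nat) (G : 'M[bool]_k) (e1 c e2 : 'I_k).
Hypotheses (Gsym : forall i j, G i j = G j i) (Gdiag : forall i, G i i).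
Hypotheses (G1c : G e1 c) (Gc2 : G c e2) (G12 : ~~ G e1 e2).
Implicit Types (a : R) (m l : nat).

(* With [l = m] every arm dies after [m] triggers, which rewards the end arms;
   with [l = T] the end arms never decay, which rewards the center. *)
Definition path_mean a m l (i : 'I_k) (n : nat) : R :=
  if i == c then (n <= m)%:R
  else if (i == e1) || (i == e2) then a * (n <= l)%:R else 0.

Let e1c : (e1 == c) = false.
Proof. by apply: contraNF G12 => /eqP ->. Qed.

Let e2c : (e2 == c) = false.
Proof. by apply: contraNF G12 => /eqP ->. Qed.

Lemma path_mean_itv a m l i n : 0 <= a <= 1 -> 0 <= path_mean a m l i n <= 1.
Proof.
move=> a01; rewrite /path_mean; case: ifP => _.
  by case: leqP => _ /=; lra.
by case: ifP => _; first case: leqP => _ /=; lra.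
Qed.

Lemma path_mean_decr a m l i n :
  0 <= a -> path_mean a m l i n.+1 <= path_mean a m l i n.
Proof.
move=> a0; have leS q : (n.+1 <= q)%:R <= (n <= q)%:R :> R.
  by rewrite ler_nat; case: ltnP => // /ltnW ->.
by rewrite /path_mean; case: ifP => // _; case: ifP => // _; rewrite ler_wpM2l.
Qed.

Local Notation total a m l := (total_mean (dirac_family (path_mean a m l)) G).
Local Notation N s i := (triggers G s i).

(* Capping the count of each end by that of the center makes every rewarded
   pull of the center worth two units of budget, even when arms outside the path
   have triggered the ends without the center. *)
Lemma total_path_decay_le a m (s : seq 'I_k) : 1 / 2 <= a ->
  total a m m s <=
    a * (minn (minn (N s e1) (N s c)) m + minn (minn (N s e2) (N s c)) m)%:R
    - (2 * a - 1) * (count_mem c (take m s))%:R.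
Proof using Gsym Gdiag G1c Gc2.
clear e1c e2c G12.
move=> a_ge; elim/last_ind: s => [|s i IH].
  by rewrite total_mean_nil /= !minn0 !min0n mulr0 mulr0 subr0.
have Ns := triggers_le G s c.
rewrite total_mean_rcons mean_dirac count_take_rcons -[pred1 c i]/(i == c).
rewrite !triggers_rcons.
move: IH; set x := total _ _ _ _; set p := count _ (take m s).
set P := (minn _ _ + _)%N => IH.
set Q := (minn _ _ + _)%N.
have step (q b : nat) (y : R) : (P + q <= Q)%N ->
    y <= a * q%:R - (2 * a - 1) * b%:R ->
    x + y <= a * Q%:R - (2 * a - 1) * (p + b)%:R.
  rewrite -(ler_nat R) (natrD _ P) (natrD _ p) => PQ yq.
  have : a * (P%:R + q%:R) <= a * Q%:R by rewrite ler_wpM2l//; lra.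
  by rewrite !mulrDr; lra.
have P_le_Q : (P + 0 <= Q)%N.
  rewrite -[0%N]/(0 + 0)%N addnACA leq_add// minn3_step ?orbT//;
    by rewrite addn0 leq_addr.
rewrite /path_mean.
have [ic|ic] := eqVneq i c.
  subst i; case: (leqP (N s c + G c c) m) => Nm.
    (* Both capped counts grow. The reward [1] is [2 * a] minus the penalty [2 * a - 1] in the first
       [m] rounds, and at most [2 * a] later. *)
    apply: (step 2%N); last by case: (_ && _) => /=; lra.
    rewrite Gdiag in Nm.
    rewrite -[2%N]/(1 + 1)%N addnACA leq_add ?minn3_step ?Gdiag ?Nm ?orbT//.
    - by rewrite Gsym G1c.
    - by rewrite Gc2.
  (* A center already triggered [m] times has at least [m] rounds behind it, so this pull incurs no
     penalty. *)
  rewrite Gdiag in Nm; have -> : (size s < m)%N = false by lia.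
  apply: (step 0%N); last by rewrite /=; lra.
  exact: P_le_Q.
rewrite andbF.
have [i1|i1] := eqVneq i e1.
  subst i; case: (leqP (N s e1 + G e1 e1) m) => Nm /=; last first.
    by apply: (step 0%N) => //; rewrite /=; lra.
  apply: (step 1%N); last by rewrite /=; lra.
  rewrite Gdiag in Nm; rewrite -[1%N]addn0 addnACA leq_add ?minn3_step//.
  - by rewrite Gdiag.
  - by rewrite G1c.
  - by rewrite Nm.
  - by rewrite addn0 leq_addr.
  - by rewrite addn0 leq_addr.
  - by rewrite orbT.
have [i2|i2] := eqVneq i e2.
  subst i; case: (leqP (N s e2 + G e2 e2) m) => Nm /=; last first.
    by apply: (step 0%N) => //; rewrite /=; lra.
  apply: (step 1%N); last by rewrite /=; lra.
  rewrite Gdiag in Nm; rewrite -[1%N]add0n addnACA leq_add ?minn3_step//.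
  - by rewrite addn0 leq_addr.
  - by rewrite addn0 leq_addr.
  - by rewrite orbT.
  - by rewrite Gdiag.
  - by rewrite Gsym Gc2.
  - by rewrite Nm.
by apply: (step 0%N) => //; rewrite /=; lra.
Qed.

(* [minn (size s) m - N s c] counts the early rounds that left the center
   untriggered, hence bounds its rewarded pulls after round [m]; those early
   rounds were spent outside the path, on reward [0]. *)
Lemma total_path_persist_le a m l (s : seq 'I_k) : 1 / 2 <= a <= 1 ->
  total a m l s <=
    a * (size s)%:R + (1 - a) * (count_mem c (take m s))%:R
    - (1 - a) * ((minn (size s) m)%:R - (minn (N s c) m)%:R).
Proof using Gsym Gdiag G1c Gc2.
clear e1c e2c G12.
move=> a_itv; elim/last_ind: s => [|s i IH].
  by rewrite total_mean_nil /= !min0n !mulr0 subrr mulr0 subr0 addr0.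
have Ns := triggers_le G s c.
rewrite count_take_rcons -[pred1 c i]/(i == c) total_mean_rcons mean_dirac.
rewrite size_rcons !triggers_rcons.
move: IH; set x := total _ _ _ _; set p := count _ (take m s) => IH.
have step (y : R) : y <= a + (1 - a) * (((size s < m)%N && (i == c))%:R
      - ((minn (size s).+1 m)%:R - (minn (size s) m)%:R)
      + ((minn (N s c + G i c) m)%:R - (minn (N s c) m)%:R)) ->
    x + y <= a * (size s).+1%:R
      + (1 - a) * (p + ((size s < m)%N && (i == c)))%:R
      - (1 - a) * ((minn (size s).+1 m)%:R - (minn (N s c + G i c) m)%:R).
  by rewrite natrD -[in a * _]natr1; nra.
apply: step; rewrite /path_mean.
have [sm|ms] := ltnP (size s) m.
  rewrite (minn_idPl sm) -natr1.
  rewrite (minn_idPl (_ : N s c + G i c <= m)%N); last by case: (G i c); lia.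
  rewrite (minn_idPl (_ : N s c <= m)%N); last by lia.
  rewrite natrD; have [ic|_] := eqVneq i c.
    by rewrite ic Gdiag /=; case: leqP => _ /=; lra.
  have [->|_] := eqVneq i e1; first by rewrite G1c /=; case: leqP => _ /=; lra.
  have [->|_] := eqVneq i e2.
    by rewrite [G e2 c]Gsym Gc2 /=; case: leqP => _ /=; lra.
  (* Reward [0] is within the bound even when the center is not triggered, since [a - (1 - a)] is
     nonnegative. *)
  by case: (G i c) => /=; lra.
rewrite (minn_idPr (leqW ms)) subrr subr0 add0r.
(* After round [m], a rewarded pull of the center raises its capped count, which pays for the excess
   [1 - a] over [a]. *)
have [ic|_] := eqVneq i c.
  rewrite ic Gdiag; case: leqP => Nm /=; last first.
    have -> : minn (N s c) m = m by lia.
    by rewrite subrr; lra.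
  by rewrite (minn_idPl (_ : N s c <= m)%N) ?natrD; [lra|lia].
set d := (X in (1 - a) * X); have d0 : 0 <= (1 - a) * d.
  by apply: mulr_ge0; [lra|rewrite subr_ge0 ler_nat; lia].
by case: ifP => _; first case: leqP => _ /=; lra.
Qed.

Definition ends_schedule m t := if (t < m)%N then e1 else e2.
Definition center_schedule m t := if (t < m)%N then c else e1.

Lemma total_path_ends_ge a m t : 0 <= a -> (0 < m)%N ->
  a * (minn t (m + m))%:R <= total a m m (mkseq (ends_schedule m) t).
Proof.
(* The second conjunct uses that [e1] does not trigger [e2]: the latter still has all its [m]
   rewarded triggers after round [m]. *)
move=> a0 m0; suff [] : a * (minn t (m + m))%:R <=
    total a m m (mkseq (ends_schedule m) t) /\
    (N (mkseq (ends_schedule m) t) e2 <= t - m)%N by [].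
elim: t => [|t [IH IHN]]; first by rewrite total_mean_nil min0n mulr0.
rewrite mkseqS total_mean_rcons mean_dirac !triggers_rcons.
have Nt := triggers_le G (mkseq (ends_schedule m) t) e1.
rewrite size_mkseq in Nt.
have [tm|tm] := ltnP t m.
  have -> : ends_schedule m t = e1 by rewrite /ends_schedule tm.
  rewrite (negbTE G12) addn0 /path_mean e1c eqxx Gdiag /=; split; last lia.
  have -> : minn t.+1 (m + m) = (minn t (m + m)).+1 by lia.
  have -> : (N (mkseq (ends_schedule m) t) e1 + 1 <= m)%N by lia.
  by rewrite -natr1 /=; lra.
have -> : ends_schedule m t = e2 by rewrite /ends_schedule ltnNge tm.
rewrite Gdiag /path_mean e2c eqxx orbT; split; last lia.
case: (ltnP t (m + m)) => tmm.
  have -> : minn t.+1 (m + m) = (minn t (m + m)).+1 by lia.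
  have -> : (N (mkseq (ends_schedule m) t) e2 + true <= m)%N by lia.
  by rewrite -natr1 /=; lra.
have -> : minn t.+1 (m + m) = minn t (m + m) by lia.
by rewrite (le_trans IH)// lerDl mulr_ge0.
Qed.

(** No count exceeds the number of rounds, so [t <= l] keeps [e1] paying although the early pulls of
    [c] trigger it too. *)
Lemma total_path_center_ge a m l t : 0 <= a <= 1 -> (t <= l)%N ->
  a * t%:R + (1 - a) * (minn t m)%:R <=
  total a m l (mkseq (center_schedule m) t).
Proof.
move=> a01; elim: t => [|t IH] tl.
  by rewrite total_mean_nil min0n !mulr0 addr0.
rewrite mkseqS total_mean_rcons mean_dirac.
have N_le i j : (N (rcons (mkseq (center_schedule m) t) j) i <= t.+1)%N.
  by rewrite (leq_trans (triggers_le _ _ _))// size_rcons size_mkseq.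
have {}IH := IH (ltnW tl).
rewrite /path_mean; have [tm|tm] := ltnP t m.
  have -> : center_schedule m t = c by rewrite /center_schedule tm.
  rewrite eqxx (leq_trans (N_le _ _))// (minn_idPl tm).
  by move: IH; rewrite (minn_idPl (ltnW tm)) -natr1 /=; lra.
have -> : center_schedule m t = e1 by rewrite /center_schedule ltnNge tm.
rewrite e1c eqxx (leq_trans (N_le _ _))// (minn_idPr (leqW tm)).
by move: IH; rewrite (minn_idPr tm) -natr1 /=; lra.
Qed.

End Path.

Lemma regret_horizon_le1 (R : realType) (k : nat) (G : 'M[bool]_k) (T : nat)
    (pi : policy R k) (i j : 'I_k) : i != j -> (T <= 1)%N ->
  exists nu : reward_family R k,
    [/\ gtb_rewards nu T, rotting nu T & (T%:R%:E <= regret nu G T pi)%E].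
Proof.
(* Since [T./2] vanishes here, the instance is built directly: the first arm chosen by [pi] pays
   [0], all others [1]. *)
move=> ij T1; pose mu (l : 'I_k) (n : nat) : R := (l != pi [::])%:R.
exists (dirac_family mu); split.
- by apply: gtb_rewards_dirac => l n; rewrite /mu; case: (l != _) => /=; lra.
- by move=> l n _ _; rewrite !mean_dirac.
pose l := if i == pi [::] then j else i.
have lpi : l != pi [::].
  by rewrite /l; have [<-|//] := eqVneq i (pi [::]); rewrite eq_sym.
apply: le_trans (regret_dirac_ge G mu pi (schedule R (fun=> l)) T).
rewrite lee_fin play_schedule.
case: T T1 => [|[|//]] _; first by rewrite total_mean_nil subrr.
rewrite mkseqS (_ : unzip1 _ = rcons [::] (pi [::]))//.
by rewrite !total_mean_rcons !total_mean_nil !mean_dirac /mu lpi eqxx /=; lra.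
Qed.

Theorem theorem11 (R : realType) (k : nat) (G : 'M[bool]_k)
    (hG : connectivity_matrix G) (hnb : ~ block_diagonal G)
    (T : nat) (pi : policy R k) :
  exists nu : reward_family R k,
    [/\ gtb_rewards nu T,
        rotting nu T
      & ((T%:R / 12)%:E <= regret nu G T pi)%E].
Proof.
have [e1 [c [e2 [G1c Gc2 G12]]]] := not_block_diagonal_path hG hnb.
have [Gtr Gdiag] := hG.
have Gsym i j : G i j = G j i by rewrite -{1}Gtr mxE.
clear hG hnb Gtr.
have [T1|T1] := leqP T 1.
  have e1c : e1 != c by apply: contraNneq G12 => ->.
  have [nu [rew rot reg]] := regret_horizon_le1 G pi e1c T1.
  exists nu; split=> //; apply: le_trans reg; rewrite lee_fin.
  by have := ler0n R T; lra.
set m := T./2.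
have m0 : (0 < m)%N by rewrite /m; lia.
have mT : (m + m <= T)%N by rewrite /m; lia.
have Tm : (T <= m + m + 1)%N by rewrite /m; lia.
clearbody m; have leq_mT := leq_trans (leq_addr m m) mT.
(* [a = 2 / 3] balances the two instances; the shift by [1 / (12 m)]
   absorbs the rounding of [T / 2] and of [m / 2]. *)
pose a : R := 2 / 3 + (12 * m%:R)^-1.
have m1 : 1 <= m%:R :> R by rewrite (ler_nat _ 1).
have am : a * m%:R = 2 / 3 * m%:R + 1 / 12 by rewrite /a; field; lra.
have a_ge : 2 / 3 <= a by rewrite lerDl invr_ge0 mulr_ge0.
have a_le : a <= 3 / 4 by rewrite -(ler_pM2r (_ : 0 < m%:R)) ?am; lra.
clearbody a.
have TmR : T%:R <= 2 * m%:R + 1 :> R.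
  by move: Tm; rewrite -(ler_nat R) !natrD; lra.
have a_itv : 1 / 2 <= a <= 1 by lra.
have /andP[a2 _] := a_itv.
have a01 : 0 <= a <= 1 by lra.
have /andP[a0 _] := a01.
have rewards l : gtb_rewards (dirac_family (path_mean e1 c e2 a m l)) T.
  by apply: gtb_rewards_dirac => i n; apply: path_mean_itv; lra.
have rot l : rotting (dirac_family (path_mean e1 c e2 a m l)) T.
  by move=> i n _ _; rewrite !mean_dirac; apply: path_mean_decr; lra.
pose arms l t := unzip1 (play G (path_mean e1 c e2 a m l) pi t).
have size_arms l t : size (arms l t) = t by rewrite size_map size_play.
have take_arms l : (m <= l)%N -> take m (arms l T) = arms m m.
  move=> ml; rewrite /arms /unzip1 -map_take take_play//.
  congr map; apply: play_eq (leqnn m) => i n nm.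
  by rewrite /path_mean nm (leq_trans nm ml).
pose p := count_mem c (arms m m).
have pm : (p <= m)%N by rewrite -[leqRHS](size_arms m) count_size.
have [large_p|small_p] := leqP m (p + p).
- exists (dirac_family (path_mean e1 c e2 a m m)); split=> //.
  apply: le_trans
    (regret_dirac_ge G _ pi (schedule R (ends_schedule e1 e2 m)) T).
  rewrite play_schedule lee_fin -/(arms m T).
  have opt := total_path_ends_ge Gdiag G1c Gc2 G12 T a0 m0.
  have := total_path_decay_le Gsym Gdiag G1c Gc2 m (arms m T) a2.
  rewrite take_arms // -/p; set P := (minn (minn _ _) _ + _)%N => pol.
  have Pm : a * P%:R <= a * (m + m)%:R.
    by rewrite ler_wpM2l// ler_nat leq_add// geq_minr.
  (* The regret is at least [(2 * a - 1) * m / 2], which equals [(2 * m + 1) / 12] by the choice of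
     [a]. *)
  have gap : (2 * a - 1) * m%:R <= (2 * a - 1) * (p + p)%:R.
    by rewrite ler_wpM2l ?ler_nat//; lra.
  rewrite (natrD _ p) in gap; rewrite (minn_idPr mT) in opt.
  by lra.
- exists (dirac_family (path_mean e1 c e2 a m T)); split=> //.
  apply: le_trans
    (regret_dirac_ge G _ pi (schedule R (center_schedule e1 c m)) T).
  rewrite play_schedule lee_fin -/(arms T T).
  have opt := total_path_center_ge Gc2 G12 m a01 (leqnn T).
  have := total_path_persist_le Gsym Gdiag G1c Gc2 m T (arms T T) a_itv.
  rewrite take_arms// -/p size_arms (minn_idPr leq_mT).
  rewrite (minn_idPr leq_mT) in opt.
  set n := minn _ m => pol.
  have nm : 0 <= (1 - a) * (m%:R - n%:R).
    by rewrite mulr_ge0 ?subr_ge0 ?ler_nat ?geq_minr//; lra.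
  (* As [2 * p + 1 <= m], the regret is at least [(1 - a) * (m + 1) / 2]; with [a <= 3 / 4] this
     again reaches [(2 * m + 1) / 12]. *)
  have gap : (1 - a) * (p + p + 1)%:R <= (1 - a) * m%:R.
    by rewrite ler_wpM2l ?ler_nat ?addn1//; lra.
  rewrite (natrD _ (p + p)) (natrD _ p) in gap.
  by lra.
Qed.
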